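(* Let $T>0$ and let $h\in C^\infty([0,T]\times\mathbf{T})$ be a smooth solution to the mean-curvature equation in space dimension $1$, $$\partial_th+\sqrt{1+(\partial_xh)^2}\,\kappa=0\quad\text{with}\quad\kappa=-\partial_x\left(\frac{\partial_xh}{\sqrt{1+(\partial_xh)^2}}\right).$$ Then the following quantities are Lyapunov functionals, i.e. each has non-positive time derivative for all $t\in[0,T]$: $$\int_{\mathbf{T}}h^2\,dx,\qquad\int_{\mathbf{T}}(\partial_th)^2\,dx,\qquad\int_{\mathbf{T}}\big(1+(\partial_xh)^2\big)\kappa^2\,dx .$$ In addition, $\int_{\mathbf{T}}h^2\,dx$ is a strong Lyapunov functional, i.e. moreover $\frac{d^2}{dt^2}\int_{\mathbf{T}}h^2\,dx\ge0$ for all $t\in[0,T]$.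
   Context: $\mathbf{T}$ is the one-dimensional torus (circle). *)

(* Defs.v *)
From Stdlib Require Import Reals Lra.
From Coquelicot Require Import Coquelicot.
Open Scope R_scope.

(* Derivative at t of f relative to [a,b]: the two-sided derivative for
   a < t < b, the one-sided derivative at t = a and t = b.  This is Coquelicot's
   [is_derive] with [locally t] restricted to [a,b]. *)
Definition is_derive_on (a b : R) (f : R -> R) (t l : R) : Prop :=
  filterdiff f (within (fun s => a <= s <= b) (locally t)) (fun y => scal y l).

Definition ex_derive_on (a b : R) (f : R -> R) (t : R) : Prop :=
  exists l, is_derive_on a b f t l.

Definition Derive_on (a b : R) (f : R -> R) (t : R) : R :=
  iota (is_derive_on a b f t).

Lemma is_derive_on_unique (a b : R) (f : R -> R) (t l1 l2 : R) :
  a < b -> a <= t <= b ->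
  is_derive_on a b f t l1 -> is_derive_on a b f t l2 -> l1 = l2.
Proof.
intros Hab Ht [_ H1] [_ H2].
assert (Hl : is_filter_lim (within (fun s => a <= s <= b) (locally t)) t).
{ intros P HP. unfold within. now apply filter_imp with (2 := HP). }
destruct (Req_dec l1 l2) as [|Hne]; [assumption | exfalso].
assert (He : 0 < Rabs (l1 - l2) / 4).
{ apply Rdiv_lt_0_compat; [apply Rabs_pos_lt; lra | lra]. }
specialize (H1 t Hl (mkposreal _ He)). specialize (H2 t Hl (mkposreal _ He)).
unfold within in H1, H2.
destruct (filter_and _ _ H1 H2) as [d Hd]. clear H1 H2.
assert (Hs : exists s, a <= s <= b /\ Rabs (s - t) < d /\ s <> t).
{ assert (Hd0 := cond_pos d).
  destruct (Rlt_dec t b) as [Htb|Htb].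
  - exists (Rmin (t + d / 2) b). unfold Rmin.
    destruct Rle_dec; (split; [lra|split; [|lra]]); rewrite Rabs_pos_eq; lra.
  - exists (Rmax (t - d / 2) a). unfold Rmax.
    destruct Rle_dec; (split; [lra|split; [|lra]]); rewrite Rabs_left; lra. }
destruct Hs as [s [Hsab [Hsd Hst]]].
destruct (Hd s Hsd) as [K1 K2]. specialize (K1 Hsab). specialize (K2 Hsab).
revert K1 K2. unfold norm, minus, plus, opp, scal, mult; simpl.
unfold mult, abs; simpl. intros K1 K2.
change (s + - t) with (s - t) in *.
assert (Hp : 0 < Rabs (s - t)) by (apply Rabs_pos_lt; lra).
assert (K : Rabs (l1 - l2) * Rabs (s - t) <= Rabs (l1 - l2) / 2 * Rabs (s - t)).
{ rewrite <- Rabs_mult.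
  replace ((l1 - l2) * (s - t)) with
    ((f s + - f t + - ((s - t) * l2)) - (f s + - f t + - ((s - t) * l1))) by ring.
  eapply Rle_trans; [apply Rabs_triang|]. rewrite Rabs_Ropp. lra. }
apply Rmult_le_reg_r in K; lra.
Qed.

Lemma Derive_on_correct (a b : R) (f : R -> R) (t : R) :
  a < b -> a <= t <= b ->
  ex_derive_on a b f t -> is_derive_on a b f t (Derive_on a b f t).
Proof.
intros Hab Ht [l Hl]. unfold Derive_on.
apply (iota_correct (is_derive_on a b f t)).
exists l. split; [exact Hl|].
intros l'. now apply (is_derive_on_unique a b f t).
Qed.

(* A function on [0,T] x R/LZ is h : R -> R -> R in (t,x), L-periodic in x;
   only its values at times t in [0,T] are relevant. *)

Definition partial_t (T : R) (h : R -> R -> R) (t x : R) : R :=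
  Derive_on 0 T (fun s => h s x) t.

Definition partial_x (h : R -> R -> R) (t x : R) : R := Derive (h t) x.

Definition continuous_strip (T : R) (h : R -> R -> R) : Prop :=
  continuous_on (fun p : R * R => 0 <= fst p <= T)
                (fun p : R * R => h (fst p) (snd p)).

Definition differentiable_strip (T : R) (h : R -> R -> R) : Prop :=
  forall t x, 0 <= t <= T ->
    ex_derive_on 0 T (fun s => h s x) t /\ ex_derive (h t) x.

(* C^n up to the boundary t = 0, t = T: every mixed partial derivative of order
   at most n, taken in any order, exists and is continuous on [0,T] x R. *)
Fixpoint Cn_strip (n : nat) (T : R) (h : R -> R -> R) : Prop :=
  continuous_strip T h /\
  match n with
  | O => True
  | S m => differentiable_strip T h /\
           Cn_strip m T (partial_t T h) /\ Cn_strip m T (partial_x h)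
  end.

(* C^infty([0,T] x R/LZ). *)
Definition smooth_torus (L T : R) (h : R -> R -> R) : Prop :=
  (forall t x, 0 <= t <= T -> h t (x + L) = h t x) /\
  (forall n, Cn_strip n T h).

Definition kappa (h : R -> R -> R) (t x : R) : R :=
  - Derive (fun y => partial_x h t y / sqrt (1 + (partial_x h t y) ^ 2)) x.

Definition mean_curvature_eq (T : R) (h : R -> R -> R) : Prop :=
  forall t x, 0 <= t <= T ->
    partial_t T h t x + sqrt (1 + (partial_x h t x) ^ 2) * kappa h t x = 0.

(* Integral over the circle R/LZ of an L-periodic function. *)
Definition torus_int (L : R) (g : R -> R) : R := RInt g 0 L.

Definition Lyapunov (T : R) (F : R -> R) : Prop :=
  forall t, 0 <= t <= T -> ex_derive_on 0 T F t /\ Derive_on 0 T F t <= 0.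

Definition strong_Lyapunov (T : R) (F : R -> R) : Prop :=
  Lyapunov T F /\
  forall t, 0 <= t <= T ->
    ex_derive_on 0 T (Derive_on 0 T F) t /\
    0 <= Derive_on 0 T (Derive_on 0 T F) t.

(* Main.v *)
(** Let [p = d_x h] and [w = d_t h].  The equation reads
    [w = d_x p / (1 + p^2) = d_x (atan p)], and [(1 + p^2) kappa^2 = w^2], so the
    second and third functionals coincide.  Integrating by parts on the circle,
    [d/dt int h^2 = - 2 int p atan p <= 0],
    [d/dt int w^2 = - 2 int (d_x w)^2 / (1 + p^2) <= 0] and
    [d^2/dt^2 int h^2 = 4 int w^2 / (1 + p^2) >= 0].
    Every derivative relative to [[0,T]] is the two-sided derivative of an
    extension, which gives the usual rules of calculus at [t = 0] and [t = T]. *)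

Require Import Defs.
From Stdlib Require Import Reals Lra.
From Coquelicot Require Import Coquelicot.
Open Scope R_scope.

(** * Derivatives relative to an interval *)

(** Properness makes limits along this filter unique, which pins down the base point in
    [filterdiff]. A point of [[a,b]] near [t] is found to the right when [t < b]; otherwise [t]
    itself serves. *)
Lemma within_interval_ProperFilter (a b t : R) :
  a < b -> a <= t <= b ->
  ProperFilter (within (fun s => a <= s <= b) (locally t)).
Proof.
intros Hab Ht. constructor; [|apply within_filter, locally_filter].
intros P [d Hd].
assert (Hd0 := cond_pos d).
destruct (Rlt_dec t b) as [Htb|Htb].
- exists (Rmin (t + d / 2) b). apply Hd.
  + change (Rabs (Rmin (t + d / 2) b - t) < d).
    unfold Rmin; destruct Rle_dec; rewrite Rabs_pos_eq; lra.
  + unfold Rmin; destruct Rle_dec; lra.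
- exists t. apply Hd; [apply ball_center | exact Ht].
Qed.

Lemma within_interval_filter_lim (a b t : R) :
  is_filter_lim (within (fun s => a <= s <= b) (locally t)) t.
Proof. intros P HP. unfold within. now apply filter_imp with (2 := HP). Qed.

(** [filterdiff] asks for the estimate at every limit point of the filter. By properness [t] is the
    only one, and scaling is linear, so the little-o estimate at [t] is all that remains. *)
Lemma is_derive_on_intro (a b : R) (f : R -> R) (t l : R) :
  a < b -> a <= t <= b ->
  is_domin (within (fun s => a <= s <= b) (locally t)) (fun s => minus s t)
    (fun s => minus (minus (f s) (f t)) (scal (minus s t) l)) ->
  is_derive_on a b f t l.
Proof.
intros Hab Ht H.
split; [exact (is_linear_scal_l (K := R_AbsRing) (V := R_NormedModule) l)|].
intros x Hx.
assert (x = t) as ->; [|exact H].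
assert (PF := within_interval_ProperFilter a b t Hab Ht).
exact (is_filter_lim_unique (V := R_NormedModule) _ _ Hx
  (within_interval_filter_lim a b t)).
Qed.

Lemma is_derive_on_restrict (a b : R) (f g : R -> R) (t l : R) :
  a < b -> a <= t <= b -> is_derive g t l ->
  (forall s, a <= s <= b -> g s = f s) -> is_derive_on a b f t l.
Proof.
intros Hab Ht [_ Hg] Hgf. apply is_derive_on_intro; [assumption..|].
intros eps. specialize (Hg t (fun P HP => HP) eps).
unfold within. generalize Hg. apply filter_imp.
intros s Hs Hsab. now rewrite <- !Hgf.
Qed.

(** Outside [[a,b]] the extension follows the line through [(t, f t)] of slope [l]. There the
    first-order error vanishes, so the estimate on [[a,b]] becomes a two-sided one. *)
Lemma is_derive_on_extend (a b : R) (f : R -> R) (t l : R) :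
  a <= t <= b -> is_derive_on a b f t l ->
  exists g, is_derive g t l /\ (forall s, a <= s <= b -> g s = f s).
Proof.
intros Ht [_ Hf].
set (g s := if Rle_dec a s then if Rle_dec s b then f s
            else f t + (s - t) * l else f t + (s - t) * l).
assert (Hg : forall s, a <= s <= b -> g s = f s).
{ intros s Hs. unfold g. destruct Rle_dec; [destruct Rle_dec|]; lra. }
exists g. split; [|exact Hg].
split; [exact (is_linear_scal_l (K := R_AbsRing) (V := R_NormedModule) l)|].
intros x Hx.
assert (x = t) as -> by
  (symmetry; exact (is_filter_lim_locally_unique (V := R_NormedModule) _ _ Hx)).
intros eps.
assert (K := Hf t (within_interval_filter_lim a b t) eps). unfold within in K.
generalize K. apply filter_imp. intros s Hs.
rewrite (Hg t Ht).
assert (Hout : norm (minus (minus (f t + (s - t) * l) (f t))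
                      (scal (minus s t) l)) <= eps * norm (minus s t)).
{ change (Rabs (f t + (s - t) * l - f t - (s - t) * l) <= eps * Rabs (s - t)).
  replace (f t + (s - t) * l - f t - (s - t) * l) with 0 by ring.
  rewrite Rabs_R0.
  apply Rmult_le_pos; [apply Rlt_le, cond_pos | apply Rabs_pos]. }
unfold g. destruct Rle_dec; [destruct Rle_dec|]; [apply Hs; lra| |]; exact Hout.
Qed.

Lemma Derive_on_unique (a b : R) (f : R -> R) (t l : R) :
  a < b -> a <= t <= b -> is_derive_on a b f t l -> Derive_on a b f t = l.
Proof.
intros Hab Ht H. apply (is_derive_on_unique a b f t); try assumption.
apply Derive_on_correct; try assumption. now exists l.
Qed.

Lemma is_derive_on_ext (a b : R) (f g : R -> R) (t l : R) :
  a < b -> a <= t <= b -> (forall s, a <= s <= b -> f s = g s) ->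
  is_derive_on a b f t l -> is_derive_on a b g t l.
Proof.
intros Hab Ht Hfg H. destruct (is_derive_on_extend _ _ _ _ _ Ht H) as [k [Hk Hkf]].
apply (is_derive_on_restrict a b g k); try assumption.
intros s Hs. rewrite (Hkf s Hs). now apply Hfg.
Qed.

Lemma Derive_on_ext (a b : R) (f g : R -> R) (t : R) :
  a < b -> a <= t <= b -> (forall s, a <= s <= b -> f s = g s) ->
  ex_derive_on a b f t -> Derive_on a b f t = Derive_on a b g t.
Proof.
intros Hab Ht Hfg [l Hl].
rewrite (Derive_on_unique a b f t l) by assumption.
symmetry. apply Derive_on_unique; try assumption.
now apply (is_derive_on_ext a b f).
Qed.

(** This rule and the next two share one scheme: extend the functions, apply the two-sided rule,
    restrict back to [[a,b]]. *)
Lemma is_derive_on_minus (a b : R) (f g : R -> R) (t lf lg : R) :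
  a < b -> a <= t <= b -> is_derive_on a b f t lf -> is_derive_on a b g t lg ->
  is_derive_on a b (fun s => f s - g s) t (lf - lg).
Proof.
intros Hab Ht Hf Hg.
destruct (is_derive_on_extend _ _ _ _ _ Ht Hf) as [f' [Hf' Ef]].
destruct (is_derive_on_extend _ _ _ _ _ Ht Hg) as [g' [Hg' Eg]].
apply (is_derive_on_restrict a b _ (fun s => f' s - g' s)); try assumption.
- exact (is_derive_minus (V := R_NormedModule) _ _ _ _ _ Hf' Hg').
- intros s Hs. now rewrite Ef, Eg.
Qed.

Lemma is_derive_on_mult (a b : R) (f g : R -> R) (t lf lg : R) :
  a < b -> a <= t <= b -> is_derive_on a b f t lf -> is_derive_on a b g t lg ->
  is_derive_on a b (fun s => f s * g s) t (lf * g t + f t * lg).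
Proof.
intros Hab Ht Hf Hg.
destruct (is_derive_on_extend _ _ _ _ _ Ht Hf) as [f' [Hf' Ef]].
destruct (is_derive_on_extend _ _ _ _ _ Ht Hg) as [g' [Hg' Eg]].
apply (is_derive_on_restrict a b _ (fun s => f' s * g' s)); try assumption.
- rewrite <- (Ef t Ht), <- (Eg t Ht).
  exact (is_derive_mult (K := R_AbsRing) _ _ _ _ _ Hf' Hg' Rmult_comm).
- intros s Hs. now rewrite Ef, Eg.
Qed.

Lemma is_derive_on_comp (a b : R) (phi f : R -> R) (t dphi lf : R) :
  a < b -> a <= t <= b -> is_derive phi (f t) dphi -> is_derive_on a b f t lf ->
  is_derive_on a b (fun s => phi (f s)) t (lf * dphi).
Proof.
intros Hab Ht Hphi Hf.
destruct (is_derive_on_extend _ _ _ _ _ Ht Hf) as [f' [Hf' Ef]].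
apply (is_derive_on_restrict a b _ (fun s => phi (f' s))); try assumption.
- rewrite <- (Ef t Ht) in Hphi.
  exact (is_derive_comp (V := R_NormedModule) _ _ _ _ _ Hphi Hf').
- intros s Hs. now rewrite Ef.
Qed.

(** * Continuity on the strip *)

(** For [0 <= T], the nearest-point retraction of the line onto [[0,T]]. *)
Definition clamp (T t : R) : R := Rmax 0 (Rmin T t).

Lemma clamp_range (T t : R) : 0 <= T -> 0 <= clamp T t <= T.
Proof.
intros HT. unfold clamp, Rmax, Rmin. repeat destruct Rle_dec; lra.
Qed.

Lemma clamp_id (T t : R) : 0 <= t <= T -> clamp T t = t.
Proof.
intros Ht. unfold clamp, Rmax, Rmin. repeat destruct Rle_dec; lra.
Qed.

Lemma clamp_contraction (T s t : R) : Rabs (clamp T s - clamp T t) <= Rabs (s - t).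
Proof.
unfold clamp, Rmax, Rmin, Rabs.
repeat destruct Rle_dec; repeat destruct Rcase_abs; lra.
Qed.

(** Freezing [f] in time beyond [[0,T]] turns continuity on the strip into joint continuity on the
    plane, the form that [uniform_continuity_2d] accepts. *)
Definition clamped_continuous (T : R) (f : R -> R -> R) : Prop :=
  forall t x, continuity_2d_pt (fun s y => f (clamp T s) y) t x.

Lemma continuous_strip_clamped (T : R) (f : R -> R -> R) :
  0 <= T -> continuous_strip T f -> clamped_continuous T f.
Proof.
intros HT Hf t x eps.
specialize (Hf (clamp T t, x) (clamp_range T t HT)
  (fun z => Rabs (z - f (clamp T t) x) < eps)).
destruct Hf as [d Hd].
{ exists eps. intros z Hz. exact Hz. }
exists d. intros u v Hu Hv.
apply (Hd (clamp T u, v)).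
- split; [|exact Hv].
  exact (Rle_lt_trans _ _ _ (clamp_contraction T u t) Hu).
- apply clamp_range, HT.
Qed.

Lemma clamped_continuous_slice (T : R) (f : R -> R -> R) (t x : R) :
  clamped_continuous T f -> 0 <= t <= T -> continuous (f t) x.
Proof.
intros Hf Ht P [e He].
destruct (Hf t x e) as [d Hd].
exists d. intros y Hy. apply He.
rewrite <- (clamp_id T t Ht).
apply Hd; [rewrite Rminus_diag, Rabs_R0; apply cond_pos | exact Hy].
Qed.

Lemma clamped_continuous_slice_ex_RInt (T : R) (f : R -> R -> R) (t a b : R) :
  clamped_continuous T f -> 0 <= t <= T -> ex_RInt (f t) a b.
Proof.
intros Hf Ht. apply (ex_RInt_continuous (V := R_CompleteNormedModule)).
intros x _. now apply (clamped_continuous_slice T).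
Qed.

Lemma clamped_continuous_mult (T : R) (f g : R -> R -> R) :
  clamped_continuous T f -> clamped_continuous T g ->
  clamped_continuous T (fun t x => f t x * g t x).
Proof. intros Hf Hg t x. exact (continuity_2d_pt_mult _ _ _ _ (Hf t x) (Hg t x)). Qed.

Lemma clamped_continuous_comp (T : R) (phi : R -> R) (f : R -> R -> R) :
  (forall y, ex_derive phi y) -> clamped_continuous T f ->
  clamped_continuous T (fun t x => phi (f t x)).
Proof.
intros Hphi Hf t x.
apply (continuity_1d_2d_pt_comp phi (fun s y => f (clamp T s) y)); [|apply Hf].
apply continuity_pt_filterlim, (ex_derive_continuous (V := R_NormedModule)), Hphi.
Qed.

(** * Differentiation under the integral sign on a closed time interval *)

(** The classical mean value theorem applies to [f] composed with [clamp T]: it is continuous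
    everywhere, and at interior times it has two-sided derivative [df]. *)
Lemma mean_value_on (T : R) (f df : R -> R) (s t : R) :
  0 < T -> (forall r, 0 <= r <= T -> is_derive_on 0 T f r (df r)) ->
  0 <= s <= T -> 0 <= t <= T ->
  exists r, Rmin t s <= r <= Rmax t s /\ f s - f t = df r * (s - t).
Proof.
intros HT Hf Hs Ht.
destruct (MVT_gen (fun r => f (clamp T r)) t s df) as [r [Hr E]].
- intros r Hr.
  assert (Hr' : 0 < r < T).
  { revert Hr; unfold Rmin, Rmax; repeat destruct Rle_dec; lra. }
  destruct (is_derive_on_extend 0 T f r (df r)) as [g [Hg Eg]]; [lra| apply Hf; lra|].
  apply (is_derive_ext_loc g); [|exact Hg].
  assert (Hd : 0 < Rmin r (T - r)) by (apply Rmin_pos; lra).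
  exists (mkposreal _ Hd). intros y Hy.
  change (Rabs (y - r) < Rmin r (T - r)) in Hy.
  apply Rabs_def2 in Hy.
  assert (H1 := Rmin_l r (T - r)). assert (H2 := Rmin_r r (T - r)).
  rewrite clamp_id by lra. apply Eg. lra.
- intros r _.
  assert (Hc := clamp_range T r (Rlt_le _ _ HT)).
  destruct (is_derive_on_extend 0 T f _ _ Hc (Hf _ Hc)) as [g [Hg Eg]].
  apply continuity_pt_filterlim.
  change (continuous (fun q => f (clamp T q)) r).
  apply (continuous_ext (fun q => g (clamp T q))).
  { intros y. apply Eg, clamp_range; lra. }
  apply (continuous_comp (U := R_UniformSpace) (V := R_UniformSpace) (clamp T) g).
  + intros P [e He]. exists e. intros y Hy. apply He.
    exact (Rle_lt_trans _ _ _ (clamp_contraction T y r) Hy).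
  + apply (ex_derive_continuous (V := R_NormedModule)). now exists (df (clamp T r)).
- exists r. rewrite !clamp_id in E by assumption. now split.
Qed.

(** By the mean value theorem the first-order error of the integrand at [x] is
    [(ft r x - ft t x) * (s - t)] with [r] between [s] and [t]. Uniform continuity of [ft] on the
    compact rectangle makes it small uniformly in [x], endpoint times included. *)
Lemma is_derive_on_RInt (T : R) (f ft : R -> R -> R) (a b t : R) :
  0 < T -> a <= b -> 0 <= t <= T ->
  (forall s x, 0 <= s <= T -> is_derive_on 0 T (fun r => f r x) s (ft s x)) ->
  clamped_continuous T f -> clamped_continuous T ft ->
  is_derive_on 0 T (fun s => RInt (f s) a b) t (RInt (ft t) a b).
Proof.
intros HT Hab Ht Hf Cf Cft. apply is_derive_on_intro; [assumption..|].
intros eps.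
(* The added [1] keeps the quotient meaningful when [a = b]; in the end [(b - a) / (b - a + 1) <= 1]
   absorbs the length of the interval. *)
assert (He : 0 < eps / (b - a + 1)).
{ apply Rdiv_lt_0_compat; [apply cond_pos | lra]. }
destruct (uniform_continuity_2d (fun s y => ft (clamp T s) y) 0 T a b
  (fun s y _ _ => Cft s y) (mkposreal _ He)) as [d Hd].
simpl in Hd.
exists d. intros s Hs Hs0.
change (Rabs (s - t) < d) in Hs.
unfold norm, minus, plus, opp, scal, mult; simpl.
unfold mult, abs; simpl.
assert (If : forall r, 0 <= r <= T -> ex_RInt (f r) a b).
{ intros r Hr. now apply (clamped_continuous_slice_ex_RInt T). }
assert (Ift : ex_RInt (ft t) a b) by now apply (clamped_continuous_slice_ex_RInt T).
assert (Hint : is_RInt (fun x => f s x - f t x - (s - t) * ft t x) a b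
  (RInt (f s) a b - RInt (f t) a b - (s - t) * RInt (ft t) a b)).
{ apply (is_RInt_minus (V := R_NormedModule) (fun x => f s x - f t x)
    (fun x => (s - t) * ft t x)).
  - apply (is_RInt_minus (V := R_NormedModule));
      apply (RInt_correct (V := R_CompleteNormedModule)); now apply If.
  - apply (is_RInt_scal (V := R_NormedModule)).
    now apply (RInt_correct (V := R_CompleteNormedModule)). }
change (Rabs (RInt (f s) a b - RInt (f t) a b - (s - t) * RInt (ft t) a b)
  <= eps * Rabs (s - t)).
apply Rle_trans with ((b - a) * (eps / (b - a + 1) * Rabs (s - t))).
- refine (norm_RInt_le_const (V := R_NormedModule) _ a b _ _ Hab _ Hint).
  intros x Hx.
  change (Rabs (f s x - f t x - (s - t) * ft t x) <= eps / (b - a + 1) * Rabs (s - t)).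
  destruct (mean_value_on T (fun r => f r x) (fun r => ft r x) s t) as [r [Hr E]];
    try assumption.
  { intros r Hr. now apply Hf. }
  rewrite E.
  replace (ft r x * (s - t) - (s - t) * ft t x)
    with ((ft r x - ft t x) * (s - t)) by ring.
  rewrite Rabs_mult. apply Rmult_le_compat_r; [apply Rabs_pos|].
  apply Rlt_le.
  assert (Hr0 : 0 <= r <= T).
  { revert Hr; unfold Rmin, Rmax; destruct Rle_dec; lra. }
  assert (Hrt : Rabs (r - t) < d).
  { eapply Rle_lt_trans; [|exact Hs].
    revert Hr; unfold Rmin, Rmax, Rabs; destruct Rle_dec;
      repeat destruct Rcase_abs; lra. }
  specialize (Hd t x r x Ht Hx Hr0 Hx Hrt).
  rewrite !clamp_id in Hd by assumption.
  apply Hd. rewrite Rminus_diag, Rabs_R0. apply cond_pos.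
- replace ((b - a) * (eps / (b - a + 1) * Rabs (s - t)))
    with ((b - a) / (b - a + 1) * (eps * Rabs (s - t))) by (field; lra).
  rewrite <- (Rmult_1_l (eps * Rabs (s - t))) at 2.
  apply Rmult_le_compat_r.
  + apply Rmult_le_pos; [apply Rlt_le, cond_pos | apply Rabs_pos].
  + apply (Rmult_le_reg_r (b - a + 1)); [lra|].
    replace ((b - a) / (b - a + 1) * (b - a + 1)) with (b - a) by (field; lra). lra.
Qed.

(* Differentiating [u t y - u t (x-1) = RInt (partial_x u t) (x-1) y] first in [t]
   under the integral, then in [y], avoids any limit at [t = 0] and [t = T]. *)
Lemma partial_t_partial_x (T : R) (u : R -> R -> R) (t x : R) :
  0 < T -> Cn_strip 2 T u -> 0 <= t <= T ->
  is_derive (partial_t T u t) x (partial_t T (partial_x u) t x).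
Proof.
intros HT [_ [Du [[_ [Dut _]] [Cux [Dux [[Cuxt _] _]]]]]] Ht.
apply continuous_strip_clamped in Cux; [|lra].
apply continuous_strip_clamped in Cuxt; [|lra].
assert (Hx : forall s y, 0 <= s <= T -> is_derive (u s) y (partial_x u s y)).
{ intros s y Hs. apply Derive_correct, Du, Hs. }
assert (HI : forall s y, 0 <= s <= T ->
  RInt (partial_x u s) (x - 1) y = u s y - u s (x - 1)).
{ intros s y Hs. apply is_RInt_unique.
  apply (is_RInt_derive (V := R_CompleteNormedModule) (u s)).
  - intros z _. now apply Hx.
  - intros z _. now apply (clamped_continuous_slice T). }
assert (HE : forall y, x - 1 < y ->
  RInt (partial_t T (partial_x u) t) (x - 1) y =
  partial_t T u t y - partial_t T u t (x - 1)).
{ intros y Hy.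
  (* Both sides are time derivatives of the same integral, one taken under the integral sign, the
     other from the closed form [HI]. *)
  apply (is_derive_on_unique 0 T (fun s => RInt (partial_x u s) (x - 1) y) t);
    try assumption.
  - apply is_derive_on_RInt; try assumption; [lra|].
    intros s z Hs. apply Derive_on_correct; try assumption. now apply Dux.
  - apply (is_derive_on_ext 0 T (fun s => u s y - u s (x - 1))); try assumption.
    + intros s Hs. symmetry. now apply HI.
    + apply is_derive_on_minus; try assumption;
        apply Derive_on_correct; try assumption; now apply Du. }
(* Since integration starts at [x - 1], [HE] covers the neighbourhood of radius [1] of [x], and the
   fundamental theorem of calculus applies at [x]. *)
apply (is_derive_ext_loc
  (fun y => partial_t T u t (x - 1) + RInt (partial_t T (partial_x u) t) (x - 1) y)).
{ exists (mkposreal 1 Rlt_0_1). intros y Hy.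
  change (Rabs (y - x) < 1) in Hy. apply Rabs_def2 in Hy.
  rewrite HE by lra. apply Rplus_minus. }
replace (partial_t T (partial_x u) t x)
  with (0 + partial_t T (partial_x u) t x) by ring.
apply (is_derive_plus (V := R_NormedModule));
  [apply (is_derive_const (V := R_NormedModule))|].
apply (is_derive_RInt (V := R_NormedModule) _ _ (x - 1)).
- apply filter_forall. intros y.
  apply (RInt_correct (V := R_CompleteNormedModule)).
  now apply (clamped_continuous_slice_ex_RInt T).
- now apply (clamped_continuous_slice T).
Qed.

(** * Periodic functions *)

Lemma Derive_periodic (f : R -> R) (L x : R) :
  (forall y, ex_derive f y) -> (forall y, f (y + L) = f y) ->
  Derive f (x + L) = Derive f x.
Proof.
intros Df Hf. symmetry. apply is_derive_unique.
apply (is_derive_ext (fun y => f (y + L))); [exact Hf|].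
auto_derive; [apply Df | exact (Rmult_1_l _)].
Qed.

Lemma RInt_periodic_derivative (F dF : R -> R) (L : R) :
  (forall x, is_derive F x (dF x)) -> (forall x, continuous dF x) ->
  F L = F 0 -> is_RInt dF 0 L 0.
Proof.
intros HF CF HL. replace 0 with (minus (F L) (F 0)) at 2.
- apply (is_RInt_derive (V := R_CompleteNormedModule)); auto.
- rewrite HL. exact (minus_eq_zero (G := R_AbelianGroup) (F 0)).
Qed.

(** Integration by parts on the circle: each use below only has to exhibit the primitive [F] of
    [f - g]. *)
Lemma RInt_minus_periodic_derivative (f g F : R -> R) (L : R) :
  (forall x, continuous f x) -> (forall x, continuous g x) ->
  (forall x, is_derive F x (f x - g x)) -> F L = F 0 ->
  RInt f 0 L = RInt g 0 L.
Proof.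
intros Cf Cg HF HL.
assert (If : ex_RInt f 0 L)
  by (apply (ex_RInt_continuous (V := R_CompleteNormedModule)); auto).
assert (Ig : ex_RInt g 0 L)
  by (apply (ex_RInt_continuous (V := R_CompleteNormedModule)); auto).
assert (H := RInt_minus (V := R_CompleteNormedModule) f g 0 L If Ig).
assert (H0 : is_RInt (fun x => f x - g x) 0 L 0).
{ apply (RInt_periodic_derivative F); auto.
  intros x. now apply (continuous_minus (V := R_NormedModule)). }
apply (is_RInt_unique (V := R_CompleteNormedModule)) in H0.
change (RInt (fun x => f x - g x) 0 L = RInt f 0 L - RInt g 0 L) in H. lra.
Qed.

Lemma RInt_nonneg (f : R -> R) (a b : R) :
  a <= b -> (forall x, continuous f x) -> (forall x, 0 <= f x) -> 0 <= RInt f a b.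
Proof.
intros Hab Cf Hf. apply RInt_ge_0; [exact Hab| |auto].
apply (ex_RInt_continuous (V := R_CompleteNormedModule)). auto.
Qed.

Lemma RInt_nonpos (f : R -> R) (a b : R) :
  a <= b -> (forall x, continuous f x) -> (forall x, f x <= 0) -> RInt f a b <= 0.
Proof.
intros Hab Cf Hf.
assert (H : 0 <= RInt (fun x => - f x) a b).
{ apply RInt_nonneg; [exact Hab| |].
  - intros x. now apply (continuous_opp (V := R_NormedModule)).
  - intros x. specialize (Hf x). lra. }
assert (E := RInt_opp (V := R_CompleteNormedModule) f a b
  (ex_RInt_continuous (V := R_CompleteNormedModule) _ _ _ (fun x _ => Cf x))).
change (RInt (fun x => - f x) a b = - RInt f a b) in E. lra.
Qed.

(** Applied below with [phi y = y ^ 2] for the functionals and with [phi y = - 2 * (y * atan y)] for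
    the dissipation of the energy. *)
Lemma is_derive_on_RInt_comp (T : R) (phi dphi : R -> R) (u ut : R -> R -> R)
  (a b t : R) :
  0 < T -> a <= b -> 0 <= t <= T ->
  (forall y, is_derive phi y (dphi y)) -> (forall y, ex_derive dphi y) ->
  (forall s x, 0 <= s <= T -> is_derive_on 0 T (fun r => u r x) s (ut s x)) ->
  clamped_continuous T u -> clamped_continuous T ut ->
  is_derive_on 0 T (fun s => RInt (fun x => phi (u s x)) a b) t
    (RInt (fun x => ut t x * dphi (u t x)) a b).
Proof.
intros HT Hab Ht Hphi Hdphi Hu Cu Cut.
apply (is_derive_on_RInt T (fun s x => phi (u s x))
  (fun s x => ut s x * dphi (u s x))); try assumption.
- intros s x Hs. apply (is_derive_on_comp 0 T phi (fun r => u r x)); auto.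
- apply clamped_continuous_comp; [intros y; now exists (dphi y) | exact Cu].
- apply clamped_continuous_mult; [exact Cut | now apply clamped_continuous_comp].
Qed.

(** [atan] has the sign of its argument; this is what makes the integral of [h ^ 2] decay. *)
Lemma mult_atan_nonneg (y : R) : 0 <= y * atan y.
Proof.
assert (H0 := atan_0).
destruct (Rtotal_order y 0) as [H|[->|H]].
- apply atan_increasing in H as H1. nra.
- lra.
- apply atan_increasing in H as H1. nra.
Qed.

(** * Integrations by parts at a fixed time *)

Lemma one_plus_sqr_pos (y : R) : 0 < 1 + y ^ 2.
Proof. assert (H := pow2_ge_0 y). lra. Qed.

Lemma one_plus_sqr_neq_0 (y : R) : 1 + y ^ 2 <> 0.
Proof. assert (H := one_plus_sqr_pos y). lra. Qed.

Lemma continuous_of_ex_derive (f : R -> R) (x : R) : ex_derive f x -> continuous f x.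
Proof. exact (ex_derive_continuous (V := R_NormedModule) f x). Qed.

(* In the next lemmas [p], [w], [q] stand for [d_x h], [d_t h] and [d_t d_x h]:
   the equation is [d_x p = w (1 + p^2)], that is, [w = d_x (atan p)]. *)

Lemma RInt_energy_dissipation (L : R) (h p w q : R -> R) :
  (forall x, is_derive h x (p x)) -> (forall x, is_derive w x (q x)) ->
  (forall x, is_derive p x (w x * (1 + p x ^ 2))) ->
  h L = h 0 -> p L = p 0 ->
  RInt (fun x => w x * (2 * h x)) 0 L = RInt (fun x => - 2 * (p x * atan (p x))) 0 L.
Proof.
intros Hh Hw Hp PLh PLp.
assert (Eh : forall x, ex_derive h x) by (intros x; eexists; apply Hh).
assert (Ew : forall x, ex_derive w x) by (intros x; eexists; apply Hw).
assert (Ep : forall x, ex_derive p x) by (intros x; eexists; apply Hp).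
(* As [w] is the derivative of [atan p], this primitive has derivative [2 h w + 2 p atan p]. *)
apply (RInt_minus_periodic_derivative _ _ (fun x => 2 * (h x * atan (p x)))).
- intros x. apply continuous_of_ex_derive. auto_derive. auto.
- intros x. apply continuous_of_ex_derive. auto_derive. auto.
- intros x. auto_derive; [auto|].
  rewrite (is_derive_unique (fun y : R => h y) _ _ (Hh x)),
    (is_derive_unique (fun y : R => p y) _ _ (Hp x)).
  field. intros H0. apply (one_plus_sqr_neq_0 (p x)). rewrite <- H0. ring.
- now rewrite PLh, PLp.
Qed.

(** The left integrand is the time derivative of [- 2 p atan p]. The function
    [atan y + y / (1 + y^2)] has derivative [2 / (1 + y^2)^2], so along [d_x p = w (1 + p^2)] its
    composition with [p] has derivative [2 w / (1 + p^2)]. *)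
Lemma RInt_second_variation (L : R) (p w q qx : R -> R) :
  (forall x, is_derive w x (q x)) -> (forall x, is_derive q x (qx x)) ->
  (forall x, is_derive p x (w x * (1 + p x ^ 2))) ->
  w L = w 0 -> p L = p 0 ->
  RInt (fun x => q x * (- 2 * (atan (p x) + p x / (1 + p x ^ 2)))) 0 L =
  RInt (fun x => 4 * (w x ^ 2 / (1 + p x ^ 2))) 0 L.
Proof.
intros Hw Hq Hp PLw PLp.
assert (Eq : forall x, ex_derive q x) by (intros x; eexists; apply Hq).
assert (Ew : forall x, ex_derive w x) by (intros x; eexists; apply Hw).
assert (Ep : forall x, ex_derive p x) by (intros x; eexists; apply Hp).
assert (Hne : forall x, 1 + p x * (p x * 1) <> 0)
  by (intros x; exact (one_plus_sqr_neq_0 (p x))).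
apply (RInt_minus_periodic_derivative _ _
  (fun x => - 2 * (w x * (atan (p x) + p x / (1 + p x ^ 2))))).
- intros x. apply continuous_of_ex_derive. auto_derive. repeat split; auto.
- intros x. apply continuous_of_ex_derive. auto_derive. repeat split; auto.
- intros x. auto_derive; [repeat split; auto|].
  rewrite (is_derive_unique (fun y : R => w y) _ _ (Hw x)),
    (is_derive_unique (fun y : R => p y) _ _ (Hp x)).
  field. intros H0. apply (one_plus_sqr_neq_0 (p x)). rewrite <- H0. ring.
- now rewrite PLw, PLp.
Qed.

(** The fraction on the left is [d_t w]. The term [- 2 w p q] is exactly what differentiating the
    weight [1 / (1 + p^2)] in the primitive [2 w q / (1 + p^2)] produces, so only the square of [q]
    survives. *)
Lemma RInt_velocity_dissipation (L : R) (p w q qx : R -> R) :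
  (forall x, is_derive w x (q x)) -> (forall x, is_derive q x (qx x)) ->
  (forall x, is_derive p x (w x * (1 + p x ^ 2))) ->
  (forall x, continuous qx x) ->
  w L = w 0 -> p L = p 0 -> q L = q 0 ->
  RInt (fun x => (qx x - 2 * w x * p x * q x) / (1 + p x ^ 2) * (2 * w x)) 0 L =
  RInt (fun x => - 2 * (q x ^ 2 / (1 + p x ^ 2))) 0 L.
Proof.
intros Hw Hq Hp Cqx PLw PLp PLq.
assert (Eq : forall x, ex_derive q x) by (intros x; eexists; apply Hq).
assert (Ew : forall x, ex_derive w x) by (intros x; eexists; apply Hw).
assert (Ep : forall x, ex_derive p x) by (intros x; eexists; apply Hp).
assert (Hne : forall x, 1 + p x * (p x * 1) <> 0)
  by (intros x; exact (one_plus_sqr_neq_0 (p x))).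
apply (RInt_minus_periodic_derivative _ _
  (fun x => 2 * (w x * q x / (1 + p x ^ 2)))).
- intros x.
  (* Only continuity is assumed of [qx], so this integrand is treated factor by factor rather than
     through differentiability. *)
  apply (continuous_mult (K := R_AbsRing)
    (fun x => (qx x - 2 * w x * p x * q x) / (1 + p x ^ 2))).
  + apply (continuous_mult (K := R_AbsRing) (fun x => qx x - 2 * w x * p x * q x)).
    * apply (continuous_minus (V := R_NormedModule)); [apply Cqx|].
      apply continuous_of_ex_derive. auto_derive. auto.
    * apply continuous_of_ex_derive. auto_derive. repeat split; auto.
  + apply continuous_of_ex_derive. auto_derive. auto.
- intros x. apply continuous_of_ex_derive. auto_derive. repeat split; auto.
- intros x. auto_derive; [repeat split; auto|].
  rewrite (is_derive_unique (fun y : R => w y) _ _ (Hw x)),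
    (is_derive_unique (fun y : R => p y) _ _ (Hp x)),
    (is_derive_unique (fun y : R => q y) _ _ (Hq x)).
  field. intros H0. apply (one_plus_sqr_neq_0 (p x)). rewrite <- H0. ring.
- now rewrite PLw, PLp, PLq.
Qed.

(** * The mean-curvature flow of graphs *)

(** The quotient rule gives [kappa = - d_x p / (1 + p^2)^(3/2)], and the factor in front removes one
    square root. *)
Lemma kappa_formula (h : R -> R -> R) (t x : R) :
  ex_derive (partial_x h t) x ->
  sqrt (1 + partial_x h t x ^ 2) * kappa h t x =
  - (partial_x (partial_x h) t x / (1 + partial_x h t x ^ 2)).
Proof.
intros Ep. unfold kappa.
change (partial_x (partial_x h) t x) with (Derive (partial_x h t) x).
set (p := partial_x h t) in *.
assert (Hpos := one_plus_sqr_pos (p x)).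
assert (Hr : sqrt (1 + p x ^ 2) * sqrt (1 + p x ^ 2) = 1 + p x ^ 2)
  by (apply sqrt_sqrt; lra).
assert (Hr0 := sqrt_lt_R0 _ Hpos).
assert (D : Derive (fun y => p y / sqrt (1 + p y ^ 2)) x =
  Derive p x / (sqrt (1 + p x ^ 2) * (1 + p x ^ 2))).
{ apply is_derive_unique. auto_derive.
  - change (p x * (p x * 1)) with (p x ^ 2). repeat split; auto; lra.
  - change (p x * (p x * 1)) with (p x ^ 2).
    set (r := sqrt (1 + p x ^ 2)) in *. rewrite <- Hr.
    (* The numerator left by the quotient rule is this difference times [d_x p]. *)
    assert (H1 : r ^ 2 - p x ^ 2 = 1) by (simpl; simpl in Hr; lra).
    replace (Derive p x / (r * (r * r)))
      with (Derive p x * (r ^ 2 - p x ^ 2) / (r * (r * r)))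
      by (rewrite H1; field; lra).
    change (Derive (fun y : R => p y) x) with (Derive p x).
    field. apply Rgt_not_eq, Hr0. }
rewrite D. field. split; apply Rgt_not_eq; assumption.
Qed.

Lemma Lyapunov_intro (T : R) (F dF : R -> R) :
  0 < T -> (forall t, 0 <= t <= T -> is_derive_on 0 T F t (dF t)) ->
  (forall t, 0 <= t <= T -> dF t <= 0) -> Lyapunov T F.
Proof.
intros HT HF HdF t Ht. split; [now exists (dF t); apply HF|].
rewrite (Derive_on_unique 0 T F t (dF t)); auto.
Qed.

Lemma Lyapunov_ext (T : R) (F G : R -> R) :
  0 < T -> (forall t, 0 <= t <= T -> F t = G t) -> Lyapunov T F -> Lyapunov T G.
Proof.
intros HT HFG HF.
apply (Lyapunov_intro T G (Derive_on 0 T F) HT).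
- intros t Ht. apply (is_derive_on_ext 0 T F); auto.
  apply Derive_on_correct; auto. now apply HF.
- intros t Ht. now apply HF.
Qed.

Theorem propositionB2 (L T : R) (hL : 0 < L) (hT : 0 < T) (h : R -> R -> R)
  (h_smooth : smooth_torus L T h)
  (h_eq : mean_curvature_eq T h) :
  Lyapunov T (fun t => torus_int L (fun x => (h t x) ^ 2)) /\
  Lyapunov T (fun t => torus_int L (fun x => (partial_t T h t x) ^ 2)) /\
  Lyapunov T (fun t =>
    torus_int L (fun x => (1 + (partial_x h t x) ^ 2) * (kappa h t x) ^ 2)) /\
  strong_Lyapunov T (fun t => torus_int L (fun x => (h t x) ^ 2)).
Proof.
destruct h_smooth as [h_per h_Cn].
set (w := partial_t T h). set (p := partial_x h).
set (px := partial_x p). set (q := partial_t T p). set (qx := partial_t T px).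
set (wt := partial_t T w).
(* Order three reaches [qx], the time derivative of [d_x^2 h], and leaves order two for [p], as the
   interchange of derivatives requires. *)
destruct (h_Cn 3%nat) as [Ch [Dh [Cn_w Cn_p]]].
fold w in Cn_w. fold p in Cn_p.
assert (Schwarz_h : forall t x, 0 <= t <= T -> is_derive (w t) x (q t x)).
{ intros t x Ht. exact (partial_t_partial_x T h t x hT (h_Cn 2%nat) Ht). }
assert (Schwarz_p : forall t x, 0 <= t <= T -> is_derive (q t) x (qx t x)).
{ intros t x Ht. exact (partial_t_partial_x T p t x hT Cn_p Ht). }
destruct Cn_w as [Cw [Dw [[Cwt _] _]]].
destruct Cn_p as [Cp [Dp [[Cq _] [Cpx [Dpx [[Cqx _] _]]]]]].
fold px in Cpx, Dpx, Cqx. fold q in Cq. fold wt in Cwt. fold qx in Cqx.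
apply continuous_strip_clamped in Ch, Cw, Cwt, Cp, Cq, Cqx; try lra.
assert (Hh : forall t x, 0 <= t <= T -> is_derive (h t) x (p t x)).
{ intros t x Ht. apply Derive_correct, Dh, Ht. }
assert (Hht : forall t x, 0 <= t <= T -> is_derive_on 0 T (fun s => h s x) t (w t x)).
{ intros t x Ht. apply Derive_on_correct; auto. now apply Dh. }
assert (Hwt : forall t x, 0 <= t <= T -> is_derive_on 0 T (fun s => w s x) t (wt t x)).
{ intros t x Ht. apply Derive_on_correct; auto. now apply Dw. }
assert (Hpt : forall t x, 0 <= t <= T -> is_derive_on 0 T (fun s => p s x) t (q t x)).
{ intros t x Ht. apply Derive_on_correct; auto. now apply Dp. }
assert (Hpxt : forall t x, 0 <= t <= T -> is_derive_on 0 T (fun s => px s x) t (qx t x)).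
{ intros t x Ht. apply Derive_on_correct; auto. now apply Dpx. }
assert (Eqw : forall t x, 0 <= t <= T ->
  w t x = - (sqrt (1 + p t x ^ 2) * kappa h t x)).
{ intros t x Ht. specialize (h_eq t x Ht). fold w p in h_eq. lra. }
assert (Ew : forall t x, 0 <= t <= T -> w t x = px t x / (1 + p t x ^ 2)).
{ intros t x Ht. rewrite (Eqw t x Ht). unfold p. rewrite kappa_formula.
  - fold p. fold px. ring.
  - now apply Dp. }
assert (Hp : forall t x, 0 <= t <= T -> is_derive (p t) x (w t x * (1 + p t x ^ 2))).
{ intros t x Ht. rewrite (Ew t x Ht).
  replace (px t x / (1 + p t x ^ 2) * (1 + p t x ^ 2)) with (px t x)
    by (field; apply one_plus_sqr_neq_0).
  apply Derive_correct, Dp, Ht. }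
(* Quotient rule in time for [w = px / (1 + p^2)], with [px] written back as [w (1 + p^2)]. *)
assert (Ewt : forall t x, 0 <= t <= T ->
  wt t x = (qx t x - 2 * w t x * p t x * q t x) / (1 + p t x ^ 2)).
{ intros t x Ht.
  apply (is_derive_on_unique 0 T (fun s => w s x) t); auto.
  apply (is_derive_on_ext 0 T (fun s => px s x * / (1 + p s x ^ 2))); auto.
  { intros s Hs. symmetry. now apply Ew. }
  replace ((qx t x - 2 * w t x * p t x * q t x) / (1 + p t x ^ 2))
    with (qx t x * / (1 + p t x ^ 2)
          + px t x * (q t x * (- (2 * p t x) / (1 + p t x ^ 2) ^ 2)))
    by (rewrite (Ew t x Ht); field; apply one_plus_sqr_neq_0).
  apply (is_derive_on_mult 0 T (fun s => px s x) (fun s => / (1 + p s x ^ 2))); auto.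
  apply (is_derive_on_comp 0 T (fun y => / (1 + y ^ 2)) (fun s => p s x)); auto.
  auto_derive; [exact (one_plus_sqr_neq_0 (p t x))|].
  field. exact (one_plus_sqr_neq_0 (p t x)). }
assert (Ph : forall t, 0 <= t <= T -> h t L = h t 0).
{ intros t Ht. rewrite <- (h_per t 0 Ht). f_equal. ring. }
assert (Pp : forall t x, 0 <= t <= T -> p t (x + L) = p t x).
{ intros t x Ht. apply Derive_periodic; [|now intros y; apply h_per].
  intros y. now apply Dh. }
assert (Pp0 : forall t, 0 <= t <= T -> p t L = p t 0).
{ intros t Ht. rewrite <- (Pp t 0 Ht). f_equal. ring. }
(* The time histories at [x = L] and [x = 0] coincide on [[0,T]], hence so do their derivatives
   relative to [[0,T]]. *)
assert (Pw0 : forall t, 0 <= t <= T -> w t L = w t 0).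
{ intros t Ht. apply Derive_on_ext; auto. now apply Dh. }
assert (Pq0 : forall t, 0 <= t <= T -> q t L = q t 0).
{ intros t Ht. apply Derive_on_ext; auto. now apply Dp. }
(* The first derivative of the energy after integration by parts; it depends on [p] alone, so
   differentiating it again brings in only [q]. *)
set (G t := RInt (fun x => - 2 * (p t x * atan (p t x))) 0 L).
assert (dF1 : forall t, 0 <= t <= T ->
  is_derive_on 0 T (fun s => torus_int L (fun x => h s x ^ 2)) t (G t)).
{ intros t Ht. unfold G.
  rewrite <- (RInt_energy_dissipation L (h t) (p t) (w t) (q t)); auto.
  apply (is_derive_on_RInt_comp T (fun y => y ^ 2) (fun y => 2 * y) h w);
    auto; try lra.
  - intros y. auto_derive; [exact I | ring].
  - intros y. auto_derive. exact I. }
assert (L1 : Lyapunov T (fun t => torus_int L (fun x => h t x ^ 2))).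
{ apply (Lyapunov_intro T _ G hT dF1). intros t Ht.
  apply RInt_nonpos; [lra| |].
  - intros x. apply continuous_of_ex_derive. auto_derive.
    assert (ex_derive (fun y => p t y) x) by now apply Dp. auto.
  - intros x. assert (H := mult_atan_nonneg (p t x)). lra. }
assert (dF2 : forall t, 0 <= t <= T ->
  is_derive_on 0 T (fun s => torus_int L (fun x => w s x ^ 2)) t
    (RInt (fun x => - 2 * (q t x ^ 2 / (1 + p t x ^ 2))) 0 L)).
{ intros t Ht.
  rewrite <- (RInt_velocity_dissipation L (p t) (w t) (q t) (qx t)); auto.
  2: { intros x. now apply (clamped_continuous_slice T). }
  rewrite (RInt_ext _ (fun x => wt t x * (2 * w t x)))
    by (intros x _; now rewrite Ewt).
  apply (is_derive_on_RInt_comp T (fun y => y ^ 2) (fun y => 2 * y) w wt);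
    auto; try lra.
  - intros y. auto_derive; [exact I | ring].
  - intros y. auto_derive. exact I. }
assert (dG : forall t, 0 <= t <= T ->
  is_derive_on 0 T G t (RInt (fun x => 4 * (w t x ^ 2 / (1 + p t x ^ 2))) 0 L)).
{ intros t Ht.
  rewrite <- (RInt_second_variation L (p t) (w t) (q t) (qx t)); auto.
  apply (is_derive_on_RInt_comp T (fun y => - 2 * (y * atan y))
    (fun y => - 2 * (atan y + y / (1 + y ^ 2))) p q); auto; try lra.
  - intros y. auto_derive; [exact I |].
    field. exact (one_plus_sqr_neq_0 y).
  - intros y. auto_derive. exact (one_plus_sqr_neq_0 y). }
assert (L2 : Lyapunov T (fun t => torus_int L (fun x => w t x ^ 2))).
{ apply (Lyapunov_intro T _ _ hT dF2). intros t Ht.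
  apply RInt_nonpos; [lra| |].
  - intros x. apply continuous_of_ex_derive. auto_derive.
    repeat split; [now exists (qx t x); apply Schwarz_p | now apply Dp |].
    exact (one_plus_sqr_neq_0 (p t x)).
  - intros x.
    assert (H : 0 <= q t x ^ 2 / (1 + p t x ^ 2)).
    { apply Rdiv_le_0_compat; [apply pow2_ge_0 | apply one_plus_sqr_pos]. }
    lra. }
split; [exact L1|]. split; [exact L2|]. split.
- apply (Lyapunov_ext T (fun t => torus_int L (fun x => w t x ^ 2)));
    [exact hT| |exact L2].
  intros t Ht. apply RInt_ext. intros x _.
  change (w t x ^ 2 = (1 + p t x ^ 2) * kappa h t x ^ 2).
  rewrite (Eqw t x Ht).
  assert (Hr : sqrt (1 + p t x ^ 2) ^ 2 = 1 + p t x ^ 2)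
    by (apply pow2_sqrt, Rlt_le, one_plus_sqr_pos).
  rewrite <- Hr at 2. ring.
- split; [exact L1|]. intros t Ht.
  (* [Derive_on] of the energy equals [G] on all of [[0,T]], endpoints included, so the derivative
     of [G] relative to [[0,T]] carries over. *)
  assert (H : is_derive_on 0 T
    (Derive_on 0 T (fun s => torus_int L (fun x => h s x ^ 2))) t
    (RInt (fun x => 4 * (w t x ^ 2 / (1 + p t x ^ 2))) 0 L)).
  { apply (is_derive_on_ext 0 T G); auto.
    intros s Hs. symmetry. apply Derive_on_unique; auto. }
  split; [eexists; exact H|].
  rewrite (Derive_on_unique _ _ _ _ _ hT Ht H).
  apply RInt_nonneg; [lra| |].
  + intros x. apply continuous_of_ex_derive. auto_derive.
    repeat split; [now exists (q t x); apply Schwarz_h | now apply Dp |].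
    exact (one_plus_sqr_neq_0 (p t x)).
  + intros x.
    assert (H0 : 0 <= w t x ^ 2 / (1 + p t x ^ 2)).
    { apply Rdiv_le_0_compat; [apply pow2_ge_0 | apply one_plus_sqr_pos]. }
    lra.
Qed.
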